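(* Let $K\subseteq\mathbb{R}^n$ be a permutation invariant closed convex cone and let $L\in\operatorname{Aut}(\lambda^{-1}(K))$. Then the following statements hold. (i) Suppose that $L=\alpha L_M$ for some $M\in \mathrm{GL}_n(\mathbb{R})$ and $\alpha\in\{-1,1\}$. If $D$ is a diagonal matrix whose diagonal entries are the singular values of $M$ in any order, then $\alpha D^2\in\operatorname{Aut}(K)$. (ii) If $L$ is a rank $1$ preserver, then $L=\alpha L_M$ for some $M\in \mathrm{GL}_n(\mathbb{R})$ and $\alpha\in\{-1,1\}$. If, in addition, $K$ is nonzero and pointed, then $\alpha=1$.
   Context: $\mathcal{S}^n$ is the space of $n\times n$ real symmetric matrices. For $X\in\mathcal{S}^n$, $\lambda(X)=(\lambda_1(X),\ldots,\lambda_n(X))$ is the vector of eigenvalues of $X$ with $\lambda_1(X)\ge\cdots\ge\lambda_n(X)$. A set $C\subseteq\mathbb{R}^n$ is permutation invariant if $PC=C$ for every $n\times n$ permutation matrix $P$; the associated spectral set is $\lambda^{-1}(C)=\{X\in\mathcal{S}^n\mid\lambda(X)\in C\}$. For $M\in \mathrm{GL}_n(\mathbb{R})$, $L_M:\mathcal{S}^n\to\mathcal{S}^n$ is defined by $L_M(X)=MXM^T$. A linear operator $L:\mathcal{S}^n\to\mathcal{S}^n$ is a rank $1$ preserver if $L(X)$ has rank $1$ whenever $X\in\mathcal{S}^n$ has rank $1$. For a cone $K$ in a finite-dimensional real vector space $V$ (here $V=\mathbb{R}^n$ or $V=\mathcal{S}^n$), $\operatorname{Aut}(K)$ is the group of bijective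 linear maps $A:V\to V$ with $AK=K$. A cone $K$ is pointed if $K\cap(-K)=\{0\}$. *)

(* Defs.v *)
From HB Require Import structures.
From mathcomp Require Import all_boot all_order all_algebra all_fingroup.
From mathcomp Require Import all_classical all_reals all_analysis.
From mathcomp Require complex.

Set Implicit Arguments.
Unset Strict Implicit.
Unset Printing Implicit Defensive.

Import Order.TTheory GRing.Theory Num.Theory.
Import numFieldNormedType.Exports.

Local Open Scope classical_set_scope.
Local Open Scope ring_scope.

Definition symmx (R : realType) (n : nat) : {pred 'M[R]_n} :=
  [pred X | X \is symmetricmx].

Lemma symmxP (R : realType) (n : nat) (X : 'M[R]_n) :
  reflect (X^T = X) (X \in @symmx R n).
Proof.
rewrite inE is_hermitianmxE expr0 scale1r map_mx_id // eq_sym.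
exact: eqP.
Qed.

Lemma symmx_submod_closed (R : realType) (n : nat) :
  submod_closed (@symmx R n).
Proof.
split=> [|a X Y /symmxP hX /symmxP hY]; apply/symmxP; first by rewrite trmx0.
by rewrite linearP /= hX hY.
Qed.

HB.instance Definition _ (R : realType) (n : nat) :=
  GRing.isSubmodClosed.Build R 'M[R]_n (@symmx R n)
    (@symmx_submod_closed R n).

(* The space S^n, as a type carrying the vector space structure induced by
   that of 'M[R]_n. *)
Record symm (R : realType) (n : nat) : Type :=
  Symm { symm_mx :> 'M[R]_n; _ : symm_mx \in @symmx R n }.

HB.instance Definition _ (R : realType) (n : nat) :=
  [isSub for @symm_mx R n].
HB.instance Definition _ (R : realType) (n : nat) :=
  [Choice of symm R n by <:].
HB.instance Definition _ (R : realType) (n : nat) :=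
  [SubChoice_isSubLmodule of symm R n by <:].

Lemma congr_symmx (R : realType) (n : nat) (M : 'M[R]_n) (X : symm R n) :
  M *m X *m M^T \in @symmx R n.
Proof.
by apply/symmxP; rewrite !trmx_mul trmxK (symmxP _ (valP X)) mulmxA.
Qed.

Definition congr_op (R : realType) (n : nat) (M : 'M[R]_n) (X : symm R n) :
  symm R n := Symm (congr_symmx M X).

(* v lists the eigenvalues of X, with multiplicity, in nonincreasing order. *)
Definition ordered_eigenvalues (R : realType) (n : nat) (X : 'M[R]_n)
    (v : 'cV[R]_n) : Prop :=
  char_poly X = \prod_(i < n) ('X - (v i 0)%:P) /\
  forall i j : 'I_n, (i <= j)%N -> v j 0 <= v i 0.

(* The default value 0 is used only when the characteristic polynomial of X
   does not split over R; by lambdaP this never happens for symmetric X. *)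
Definition lambda (R : realType) (n : nat) (X : 'M[R]_n) : 'cV[R]_n :=
  xget 0 [set v | ordered_eigenvalues X v].

Lemma ordered_eigenvalues_seqP (R : realType) (n : nat) (v : 'cV[R]_n) :
  (forall i j : 'I_n, (i <= j)%N -> v j 0 <= v i 0) <->
  sorted >=%R [seq v i 0 | i <- enum 'I_n].
Proof.
have tr : transitive (>=%R : rel R) by move=> y x z yx zy; exact: le_trans yx.
have nthv (i : 'I_n) : nth 0 [seq v k 0 | k <- enum 'I_n] i = v i 0.
  by rewrite (nth_map i) ?size_enum_ord // nth_ord_enum.
have sz : size [seq v k 0 | k <- enum 'I_n] = n.
  by rewrite size_map size_enum_ord.
split=> [hv|hv i j ij].
  apply/(sortedP 0) => i; rewrite sz => hi.
  have := hv (Ordinal (ltnW hi)) (Ordinal hi) (leqnSn i).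
  by rewrite -!nthv.
rewrite -!nthv.
by apply: (sorted_leq_nth tr (@lexx _ R) 0 hv); rewrite ?inE ?sz.
Qed.

Lemma ordered_eigenvalues_uniq (R : realType) (n : nat) (X : 'M[R]_n)
    (u v : 'cV[R]_n) :
  ordered_eigenvalues X u -> ordered_eigenvalues X v -> u = v.
Proof.
move=> [Xu /ordered_eigenvalues_seqP su] [Xv /ordered_eigenvalues_seqP sv].
have : perm_eq [seq u i 0 | i <- enum 'I_n] [seq v i 0 | i <- enum 'I_n].
  apply: prod_XsubC_eq; rewrite !big_map.
  by move: Xv; rewrite Xu -[LHS]big_enum -[RHS]big_enum.
have tr : transitive (>=%R : rel R) by move=> y x z yx zy; exact: le_trans yx.
have asym : antisymmetric (>=%R : rel R).
  by move=> x y /andP[yx xy]; apply/le_anti/andP.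
move=> /(sorted_eq tr asym su sv) uv.
have nthE (w : 'cV[R]_n) (i : 'I_n) :
    nth 0 [seq w k 0 | k <- enum 'I_n] i = w i 0.
  by rewrite (nth_map i) ?size_enum_ord // nth_ord_enum.
by apply/colP => i; rewrite -!nthE uv.
Qed.

Section Spectrum.
Import complex.

Lemma symm_ordered_eigenvalues (R : realType) (n : nat) (X : symm R n) :
  exists v, ordered_eigenvalues X v.
Proof.
suff [d Xd] : exists d : 'I_n -> R, char_poly X = \prod_i ('X - (d i)%:P).
  pose s := sort >=%R [seq d i | i <- enum 'I_n].
  have sz : size s = n by rewrite size_sort size_map size_enum_ord.
  have sE : [seq (\col_(i < n) nth 0 s i) i 0 | i <- enum 'I_n] = s.
    apply: (@eq_from_nth _ 0); first by rewrite size_map size_enum_ord sz.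
    move=> i; rewrite size_map size_enum_ord => hi.
    by rewrite (nth_map (Ordinal hi)) ?size_enum_ord // mxE nth_enum_ord.
  exists (\col_(i < n) nth 0 s i); split.
    rewrite Xd -[LHS]big_enum -[RHS]big_enum /=.
    rewrite -(big_map d xpredT (fun x => 'X - x%:P)).
    rewrite -(big_map (fun i => (\col_(i < n) nth 0 s i) i 0) xpredT
                      (fun x => 'X - x%:P)) sE.
    by apply: perm_big; rewrite perm_sym perm_sort.
  apply/ordered_eigenvalues_seqP; rewrite sE.
  by apply: sort_sorted => x y; exact: le_total.
pose f := real_complex R : {rmorphism R -> complex R}.
pose A := map_mx f X.
have Areal : A \is a mxOver Num.real.
  apply/mxOverP => i j; rewrite mxE; apply/complex_realP.
  by exists (symm_mx X i j).
have Asym : A \is symmetricmx.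
  apply/is_hermitianmxP; rewrite expr0 scale1r map_mx_id // map_trmx.
  by rewrite (symmxP _ (valP X)).
have Aherm := realsym_hermsym Asym Areal.
have /mxOverP Dreal := hermitian_spectral_diag_real Aherm.
have /orthomx_spectralP AE := hermitian_normalmx Aherm.
have Pu := spectral_unit A.
set P := spectralmx A in AE Pu; set D := spectral_diag A in AE Dreal.
have cA : char_poly A = \prod_i ('X - (D 0 i)%:P).
  have charE : char_poly_mx A = map_mx (@polyC _) (invmx P) *m
      char_poly_mx (diag_mx D) *m map_mx (@polyC _) P.
    rewrite /char_poly_mx mulmxBr mulmxBl -!map_mxM -AE; congr (_ - _).
    by rewrite scalar_mxC -mulmxA -map_mxM mulVmx // map_mx1 mulmx1.
  have -> : char_poly A = char_poly (diag_mx D).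
    rewrite /char_poly charE !det_mulmx mulrAC -det_mulmx -map_mxM mulVmx //.
    by rewrite map_mx1 det1 mul1r.
  rewrite char_poly_trig ?diag_mx_is_trig //.
  by apply: eq_bigr => i _; rewrite mxE eqxx mulr1n.
have {}Dreal i : exists k, D 0 i = f k by apply/complex_realP.
have [d dE] := choice Dreal.
exists d; apply: (map_poly_inj f); rewrite map_char_poly -/A cA rmorph_prod.
by apply: eq_bigr => i _; rewrite dE rmorphB /= map_polyX map_polyC.
Qed.

End Spectrum.

Lemma lambdaP (R : realType) (n : nat) (X : symm R n) :
  ordered_eigenvalues X (lambda X).
Proof.
have [v hv] := symm_ordered_eigenvalues X.
exact: (@xgetPex _ 0 [set v | ordered_eigenvalues X v] (ex_intro _ v hv)).
Qed.

Definition singular_values (R : realType) (n : nat) (M : 'M[R]_n) : 'cV[R]_n :=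
  map_mx Num.sqrt (lambda (M^T *m M)).

Definition permutation_invariant (R : realType) (n : nat)
    (C : set 'cV[R]_n) : Prop :=
  forall s : 'S_n, [set perm_mx s *m x | x in C] = C.

Definition spectral_set (R : realType) (n : nat) (C : set 'cV[R]_n) :
  set (symm R n) := [set X | C (lambda X)].

Definition cone (R : realType) (V : lmodType R) (K : set V) : Prop :=
  K !=set0 /\ forall (t : R) (x : V), 0 <= t -> K x -> K (t *: x).

Definition convex_cone (R : realType) (V : lmodType R) (K : set V) : Prop :=
  cone K /\ convex_set (K : set (convex_lmodType V)).

Definition pointed (R : realType) (V : lmodType R) (K : set V) : Prop :=
  K `&` [set - x | x in K] = [set 0].

Definition in_Aut (R : realType) (V : lmodType R) (K : set V)
    (A : {linear V -> V}) : Prop :=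
  bijective A /\ [set A x | x in K] = K.

Definition rank1_preserver (R : realType) (n : nat)
    (L : {linear symm R n -> symm R n}) : Prop :=
  forall X : symm R n, \rank X = 1%N -> \rank (L X) = 1%N.

(* Main.v *)
Require Import Defs.
From mathcomp Require Import all_boot all_order all_algebra all_fingroup.
From mathcomp Require Import all_classical all_reals all_analysis.
From mathcomp Require Import ring lra.
Import Order.TTheory GRing.Theory Num.Theory.
Import numFieldNormedType.Exports.
Local Open Scope classical_set_scope.
Local Open Scope ring_scope.

Set Implicit Arguments.
Unset Strict Implicit.
Unset Printing Implicit Defensive.

(** Membership of X in the spectral set of K only depends on the spectrum of X:
if V is orthogonal, V diag(x) V^T belongs to the spectral set exactly when x
belongs to K ([spectral_set_congr]). Together with the real spectral theorem
([orthogonal_diagonalization]) this moves every question between K and its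
spectral set.

Diagonal automorphisms. Write the singular value decomposition of M as
M V = U D, with the singular values on the diagonal of D in the prescribed order
([singular_value_decomposition]). Then alpha L_M maps V diag(x) V^T to
U diag(alpha D^2 x) U^T ([congr_op_diag]), and as L maps the spectral set onto
itself, x lies in K if and only if alpha D^2 x does.

Rank one preservers. An injective L that preserves rank one is, up to sign, a
congruence ([rank1_preserver_congr]). Rank one symmetric matrices are the
matrices eps x x^T with eps = 1 or -1 and x nonzero. For independent x and z the
matrices (x + t z)(x + t z)^T have rank one for all t, so their images
eps a a^T + t B + t^2 del c c^T also do. The vanishing of all 2 x 2 minors for
every t forces eps = del and B = (a c^T + c a^T) up to sign ([rank1_pencil]).
Hence, for one fixed x, every z has a vector f(z) such that
L(z z^T) = eps f(z) f(z)^T and L(x z^T + z x^T) = eps (a f(z)^T + f(z) a^T)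
([preserver_polar]). The second identity determines f(z) and depends linearly
on z, so f is linear and its matrix is the required M. By the spectral theorem
the matrices z z^T span the symmetric matrices, so L is eps L_M.

Sign. Summing the images of a nonzero x in K under all permutations gives a
constant vector of K, and this vector is nonzero when K is pointed. If alpha
were negative, the image under L of the corresponding scalar matrix would yield,
by the same averaging, a constant vector of K of the opposite sign
([pointed_congr_sign]). *)

(** * Inner products and outer products *)

Definition dot (R : realType) (n : nat) (u v : 'cV[R]_n) : R := (u^T *m v) 0 0.

Lemma dotE (R : realType) (n : nat) (u v : 'cV[R]_n) :
  dot u v = \sum_i u i 0 * v i 0.
Proof. by rewrite /dot mxE; apply: eq_bigr => i _; rewrite mxE. Qed.

Lemma dotC (R : realType) (n : nat) (u v : 'cV[R]_n) : dot u v = dot v u.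
Proof. by rewrite !dotE; apply: eq_bigr => i _; rewrite mulrC. Qed.

Lemma dot_eq0 (R : realType) (n : nat) (u : 'cV[R]_n) :
  (dot u u == 0) = (u == 0).
Proof.
apply/eqP/eqP => [|->]; last by rewrite /dot mulmx0 mxE.
rewrite dotE => /psumr_eq0P h; apply/colP => i; rewrite mxE; apply/eqP.
by rewrite -sqrf_eq0 expr2 h // => j _; rewrite -expr2 sqr_ge0.
Qed.

Lemma dot_gt0 (R : realType) (n : nat) (u : 'cV[R]_n) :
  (0 < dot u u) = (u != 0).
Proof.
rewrite lt_neqAle eq_sym dot_eq0 dotE sumr_ge0 ?andbT // => i _.
by rewrite -expr2 sqr_ge0.
Qed.

Lemma dotDr (R : realType) (n : nat) (u v w : 'cV[R]_n) :
  dot w (u + v) = dot w u + dot w v.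
Proof. by rewrite /dot mulmxDr mxE. Qed.

Lemma dotBl (R : realType) (n : nat) (u v w : 'cV[R]_n) :
  dot (u - v) w = dot u w - dot v w.
Proof. by rewrite /dot linearB /= mulmxBl !mxE. Qed.

Lemma dotBr (R : realType) (n : nat) (u v w : 'cV[R]_n) :
  dot w (u - v) = dot w u - dot w v.
Proof. by rewrite dotC dotBl !(dotC w). Qed.

Lemma dotZl (R : realType) (n : nat) (k : R) (u w : 'cV[R]_n) :
  dot (k *: u) w = k * dot u w.
Proof. by rewrite /dot linearZ /= -scalemxAl !mxE. Qed.

Lemma dotZr (R : realType) (n : nat) (k : R) (u w : 'cV[R]_n) :
  dot w (k *: u) = k * dot w u.
Proof. by rewrite dotC dotZl dotC. Qed.

Lemma mul_outer (R : realType) (n : nat) (u v w : 'cV[R]_n) :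
  u *m v^T *m w = dot v w *: u.
Proof.
by rewrite -mulmxA [v^T *m w]mx11_scalar mul_mx_scalar.
Qed.

Lemma outer_eq0 (R : realType) (n : nat) (x : 'cV[R]_n) :
  x *m x^T = 0 -> x = 0.
Proof.
move=> xx; apply/eqP; rewrite -dot_eq0 -sqrf_eq0 expr2 -dotZr -mul_outer xx.
by rewrite mul0mx -(scale0r x) dotZr mul0r.
Qed.

(** * The real spectral theorem *)

(** Householder: the reflection in the hyperplane orthogonal to u - v exchanges
u and v. It replaces the completion of a unit vector to an orthonormal basis. *)
Lemma reflection_exists (R : realType) (n : nat) (u v : 'cV[R]_n) :
  dot u u = dot v v ->
  exists H : 'M[R]_n, [/\ H^T = H, H *m H = 1%:M & H *m u = v].
Proof.
move=> uv; have [<-|neq] := eqVneq u v.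
  by exists 1%:M; rewrite trmx1 mul1mx mul1mx.
have [w wE] : exists w, w = u - v by exists (u - v).
have w0 : dot w w != 0 by rewrite dot_eq0 wE subr_eq0.
exists (1%:M - (2 / dot w w) *: (w *m w^T)); split.
- by rewrite linearB linearZ /= trmx1 trmx_mul trmxK.
- rewrite mulmxBr mulmx1 mulmxBl mul1mx -!scalemxAr -scalemxAl scalerA.
  rewrite mulmxA mul_outer -scalemxAl !scalerA.
  rewrite (_ : _ * _ * _ = (2 / dot w w) + (2 / dot w w)); last by field.
  by rewrite scalerDl opprB addrK subrK.
rewrite mulmxBl mul1mx -scalemxAl mul_outer scalerA.
have -> : dot w u = dot w w / 2.
  by rewrite wE !dotBr !dotBl (dotC v u) -uv; lra.
rewrite (_ : _ * _ = 1); last by field.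
by rewrite scale1r wE subKr.
Qed.

Lemma char_poly_conj (R : realType) (n : nat) (P Q A : 'M[R]_n) :
  Q *m P = 1%:M -> char_poly (P *m A *m Q) = char_poly A.
Proof.
move=> QP; have PQ := mulmx1C QP.
have E : char_poly_mx (P *m A *m Q) =
    map_mx (@polyC _) P *m char_poly_mx A *m map_mx (@polyC _) Q.
  rewrite /char_poly_mx mulmxBr mulmxBl -!map_mxM; congr (_ - _).
  by rewrite scalar_mxC -mulmxA -map_mxM PQ map_mx1 mulmx1.
by rewrite /char_poly E !det_mulmx mulrAC -det_mulmx -map_mxM PQ map_mx1 det1
  mul1r.
Qed.

(** The eigenvalues and their order are prescribed through the factorization of
the characteristic polynomial. So the induction can always split off the first
factor, with no permutation of the eigenvalues, and diagonalizations with the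
spectrum in any order come for free. *)
Lemma orthogonal_diagonalization (R : realType) (n : nat) (X : 'M[R]_n)
    (w : 'I_n -> R) :
  X^T = X -> char_poly X = \prod_i ('X - (w i)%:P) ->
  exists V : 'M[R]_n, V^T *m V = 1%:M /\ X = V *m diag_mx (\row_i w i) *m V^T.
Proof.
elim: n X w => [|n IH] X w symX.
  by move=> _; exists 1%:M; split; apply/matrixP => -[].
rewrite big_ord_recl => cX.
have : root (char_poly X) (w ord0) by rewrite cX rootM root_XsubC eqxx.
rewrite -eigenvalue_root_char => /eigenvalueP[r rX r0].
pose v := r^T; have v0 : v != 0 by rewrite trmx_eq0.
have Xv : X *m v = w ord0 *: v.
  by rewrite -[LHS]trmxK trmx_mul symX trmxK rX linearZ.
pose v1 := (Num.sqrt (dot v v))^-1 *: v.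
have Xv1 : X *m v1 = w ord0 *: v1.
  by rewrite -scalemxAr Xv !scalerA mulrC.
pose e : 'cV[R]_n.+1 := delta_mx (lshift n (0 : 'I_1)) 0.
have vv : 0 < dot v v by rewrite dot_gt0.
have [] := @reflection_exists R n.+1 e v1.
  rewrite /v1 dotZl dotZr mulrA -invfM -expr2 sqr_sqrtr ?mulVf ?ltW ?gt_eqF //.
  by rewrite /dot trmx_delta mul_delta_mx mxE !eqxx.
move=> H [HT HH He].
have Hv : H *m v1 = e by rewrite -He mulmxA HH mul1mx.
have [Y YX] : exists Y : 'M[R]_(1 + n), Y = H *m X *m H by eexists.
have YT : Y^T = Y by rewrite YX !trmx_mul symX HT mulmxA.
have Ye : Y *m e = w ord0 *: e.
  by rewrite YX -!mulmxA He Xv1 -scalemxAr Hv.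
(* The first basis vector is an eigenvector of Y, which is also symmetric, so Y
   is block diagonal. *)
have Y0 (i : 'I_(1 + n)) : Y i (lshift n 0) = w ord0 * (i == lshift n 0)%:R.
  have := congr1 (fun M : 'cV_n.+1 => M i 0) Ye.
  rewrite -[e]/(delta_mx (lshift n (0 : 'I_1)) 0).
  by rewrite -colE !mxE eqxx andbT.
pose Y' := drsubmx Y.
have YE : Y = block_mx (w ord0)%:M 0 0 Y'.
  rewrite -[LHS]submxK; congr block_mx; apply/matrixP => i j; rewrite !ord1.
  - by rewrite !mxE Y0 eqxx mulr1.
  - by rewrite !mxE -YT mxE Y0 (_ : (_ == _) = false) ?mulr0.
  - by rewrite !mxE Y0 (_ : (_ == _) = false) ?mulr0.
have symY' : Y'^T = Y' by rewrite /Y' trmx_drsub YT.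
have cY : char_poly Y = char_poly X by rewrite YX; exact: char_poly_conj.
have cY' : char_poly Y' = \prod_i ('X - (w (lift ord0 i))%:P).
  have : char_poly Y = ('X - (w ord0)%:P) * char_poly Y'.
    rewrite YE /char_poly /char_poly_mx map_block_mx scalar_mx_block.
    rewrite opp_block_mx add_block_mx !map_mx0 !subr0 det_ublock.
    by rewrite map_scalar_mx -rmorphB /= det_scalar expr1.
  rewrite cY cX => /mulfI; rewrite polyXsubC_eq0 => /(_ isT) <- //.
have [V' [V'V Y'E]] := IH _ _ symY' cY'.
pose B : 'M[R]_(1 + n) := block_mx 1%:M 0 0 V'.
have BB : B^T *m B = 1%:M.
  rewrite /B tr_block_mx !trmx0 trmx1 mulmx_block !mulmx0 !mul0mx !mulmx1.
  by rewrite !addr0 !add0r V'V -scalar_mx_block.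
have diagE : diag_mx (\row_i w i) = block_mx (w ord0)%:M 0 0
    (diag_mx (\row_i w (lift ord0 i))) :> 'M[R]_(1 + n).
  apply/matrixP => i j; rewrite !mxE.
  case: (splitP i) => [i'|i'] Ei; rewrite !mxE;
    case: (splitP j) => [j'|j'] Ej; rewrite !mxE.
  - rewrite !ord1; move: Ei Ej; rewrite !ord1 => Ei Ej.
    have -> : i = ord0 by apply/val_inj.
    by have -> : j = ord0 by apply/val_inj.
  - by rewrite (_ : (i == j) = false) // -val_eqE /= Ei Ej ord1.
  - by rewrite (_ : (i == j) = false) // -val_eqE /= Ei Ej ord1.
  - have -> : i = lift ord0 i' by apply/val_inj.
    have -> : j = lift ord0 j' by apply/val_inj.
    by rewrite (inj_eq lift_inj).
have YB : Y = B *m block_mx (w ord0)%:M 0 0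
    (diag_mx (\row_i w (lift ord0 i))) *m B^T.
  rewrite YE /B tr_block_mx !trmx0 trmx1 !mulmx_block.
  by rewrite !mulmx0 !mul0mx !mulmx1 !addr0 !add0r mul1mx mul0mx Y'E.
exists (H *m B); split.
  by rewrite trmx_mul HT mulmxA -(mulmxA B^T) HH mulmx1.
have -> : X = H *m Y *m H.
  by rewrite YX !mulmxA HH mul1mx -mulmxA HH mulmx1.
by rewrite YB -diagE trmx_mul HT !mulmxA.
Qed.

(** * Spectral sets and singular values *)

(** Unique factorization: a spectrum is determined up to order. *)
Lemma prod_XsubC_perm (R : realType) (n : nat) (u w : 'cV[R]_n) :
  \prod_i ('X - (u i 0)%:P) = \prod_i ('X - (w i 0)%:P) ->
  exists s : 'S_n, u = perm_mx s *m w.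
Proof.
move=> uw.
have : perm_eq [seq u i 0 | i <- enum 'I_n] [tuple w i 0 | i < n].
  apply: prod_XsubC_eq; rewrite !big_map.
  by move: uw; rewrite -[LHS]big_enum -[RHS]big_enum.
move=> /tuple_permP[s us]; exists s; apply/colP => i.
rewrite -row_permE mxE.
have := congr1 (fun l => nth 0 l i) us.
rewrite (nth_map i) ?size_enum_ord // nth_ord_enum => ->.
by rewrite -tnth_nth !tnth_mktuple.
Qed.

Lemma spectral_setP (R : realType) (n : nat) (K : set 'cV[R]_n) (X : symm R n)
    (w : 'cV[R]_n) :
  permutation_invariant K -> char_poly X = \prod_i ('X - (w i 0)%:P) ->
  spectral_set K X <-> K w.
Proof.
move=> permK Xw; rewrite /spectral_set /=.
have [Xl _] := lambdaP X.
have Kperm s x : K x -> K (perm_mx s *m x).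
  by move=> Kx; rewrite -[K](permK s); exists x.
split.
  have [|s ->] := @prod_XsubC_perm _ _ w (lambda X); first by rewrite -Xw.
  exact: Kperm.
have [|s ->] := @prod_XsubC_perm _ _ (lambda X) w; first by rewrite -Xl.
exact: Kperm.
Qed.

Lemma diag_symmx (R : realType) (n : nat) (x : 'cV[R]_n) :
  diag_mx x^T \in @symmx R n.
Proof. by apply/symmxP; rewrite tr_diag_mx. Qed.

Definition diag_symm (R : realType) (n : nat) (x : 'cV[R]_n) : symm R n :=
  Symm (diag_symmx x).

Lemma spectral_set_congr (R : realType) (n : nat) (K : set 'cV[R]_n)
    (V : 'M[R]_n) (x : 'cV[R]_n) :
  permutation_invariant K -> V^T *m V = 1%:M ->
  spectral_set K (congr_op V (diag_symm x)) <-> K x.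
Proof.
move=> permK VV; apply: spectral_setP => //.
rewrite char_poly_conj // char_poly_trig ?diag_mx_is_trig //.
by apply: eq_bigr => i _; rewrite !mxE eqxx mulr1n.
Qed.

(** Diagonalize M^T M = V D^2 V^T with the eigenvalues in the order of D. The
columns of M V are then orthogonal, of lengths the diagonal entries of D, and U
is M V D^-1. *)
Lemma singular_value_decomposition (R : realType) (n : nat) (M D : 'M[R]_n)
    (s : 'S_n) :
  M \in unitmx -> is_diag_mx D ->
  (forall i, D i i = singular_values M (s i) 0) ->
  exists U V : 'M[R]_n, [/\ U^T *m U = 1%:M, V^T *m V = 1%:M, D \in unitmx
    & M *m V = U *m D].
Proof.
move=> uM diagM Ds; have /is_diag_mxP diagD := diagM.
have symG : M^T *m M \in @symmx R n by apply/symmxP; rewrite trmx_mul trmxK.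
have [cG _] := lambdaP (Symm symG).
have [|V [VV GE]] := @orthogonal_diagonalization R n (M^T *m M)
    (fun i => lambda (M^T *m M) (s i) 0) (symmxP _ symG).
  by rewrite cG (reindex_inj (@perm_inj _ s)).
have MVE : (M *m V)^T *m (M *m V) = diag_mx (\row_i lambda (M^T *m M) (s i) 0).
  rewrite trmx_mul mulmxA -(mulmxA V^T) [in LHS]GE !mulmxA VV mul1mx.
  by rewrite -mulmxA VV mulmx1.
have DD : D *m D = (M *m V)^T *m (M *m V).
  apply/matrixP => i j; rewrite MVE !mxE (bigD1 i) //= big1 ?addr0; last first.
    by move=> k ki; rewrite diagD ?mul0r // eq_sym.
  have [<-|ij] := eqVneq i j; last by rewrite (diagD _ _ ij) mulr0.
  rewrite Ds mxE -expr2 sqr_sqrtr ?mulr1n //.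
  have := congr1 (fun A : 'M[R]_n => A i i) MVE; rewrite !mxE eqxx mulr1n => <-.
  by apply: sumr_ge0 => k _; rewrite mxE -expr2 sqr_ge0.
have DT : D^T = D by case/diag_mxP: diagM => d ->; rewrite tr_diag_mx.
have uV : V \in unitmx by case/mulmx1_unit: VV.
have uD : D \in unitmx.
  have : D *m D \in unitmx by rewrite DD unitmx_mul unitmx_tr unitmx_mul uM uV.
  by rewrite unitmx_mul => /andP[].
exists (M *m V *m invmx D), V; split=> //; last by rewrite mulmxKV.
rewrite trmx_mul trmx_inv DT mulmxA -(mulmxA (invmx D)) -DD.
by rewrite mulmxA mulVmx // mul1mx mulmxV.
Qed.

Lemma in_Aut_iff (R : realType) (V : lmodType R) (K : set V)
    (A : {linear V -> V}) :
  in_Aut K A -> forall x, K (A x) <-> K x.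
Proof.
move=> [bA AK] x; split=> [|Kx]; last by rewrite -AK; exists x.
by rewrite -{1}AK => -[y Ky /(bij_inj bA)<-].
Qed.

(** The congruence by M followed by the singular value decomposition of M turns
into a diagonal action on spectra. *)
Lemma congr_op_diag (R : realType) (n : nat) (alpha : R) (M U V D : 'M[R]_n)
    (x : 'cV[R]_n) :
  is_diag_mx D -> M *m V = U *m D ->
  alpha *: congr_op M (congr_op V (diag_symm x)) =
  congr_op U (diag_symm (alpha *: (D *m D) *m x)).
Proof.
move=> /diag_mxP[d ->] MV; apply/val_inj; rewrite linearZ /=.
rewrite !mulmxA MV -[in LHS]mulmxA -trmx_mul MV trmx_mul tr_diag_mx !mulmxA.
rewrite -!(mulmxA U) !mulmx_diag scalemxAr scalemxAl -linearZ /=.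
congr (_ *m (diag_mx _ *m _)); apply/rowP => i.
by rewrite -scalemxAl mul_diag_mx !mxE mulrAC.
Qed.

Lemma diagonal_in_Aut (R : realType) (n : nat) (K : set 'cV[R]_n)
    (L : {linear symm R n -> symm R n}) (M D : 'M[R]_n) (alpha : R) (s : 'S_n) :
  permutation_invariant K -> in_Aut (spectral_set K) L ->
  M \in unitmx -> alpha != 0 ->
  (forall X : symm R n, L X = alpha *: congr_op M X) ->
  is_diag_mx D -> (forall i, D i i = singular_values M (s i) 0) ->
  in_Aut K (mulmx (alpha *: (D *m D)) : {linear 'cV[R]_n -> 'cV[R]_n}).
Proof.
move=> permK AutL uM alpha0 LE diagD DE.
have [U [V [UU VV uD MV]]] := singular_value_decomposition uM diagD DE.
have KE x : K (alpha *: (D *m D) *m x) <-> K x.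
  rewrite -(spectral_set_congr x permK VV) -(in_Aut_iff AutL) LE.
  rewrite (congr_op_diag alpha x diagD MV); symmetry.
  exact: spectral_set_congr.
have uA : alpha *: (D *m D) \in unitmx.
  by rewrite unitmxZ ?unitfE // unitmx_mul uD.
split.
  exists (mulmx (invmx (alpha *: (D *m D)))) => x; [exact: mulKmx |].
  exact: mulKVmx.
apply/seteqP; split=> [_ [x Kx <-]|y Ky]; first exact/KE.
exists (invmx (alpha *: (D *m D)) *m y); last exact: mulKVmx.
by apply/KE; rewrite mulKVmx.
Qed.

(** * Pencils of rank one symmetric matrices *)

Lemma dot_outer (R : realType) (n : nat) (k : R) (d u v : 'cV[R]_n) :
  dot u (k *: (d *m d^T) *m v) = k * dot u d * dot v d.
Proof.
by rewrite -scalemxAl mul_outer !dotZr (dotC d); ring.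
Qed.

Lemma eq_dot_mx (R : realType) (n : nat) (A B : 'M[R]_n) :
  (forall u v, dot u (A *m v) = dot u (B *m v)) -> A = B.
Proof.
move=> AB; apply/matrixP => i j.
have := AB (delta_mx i 0) (delta_mx j 0).
by rewrite /dot -!colE trmx_delta -!rowE !mxE.
Qed.

Lemma cubic_eq0 (R : realType) (a b c : R) :
  (forall t, t * a + t ^+ 2 * b + t ^+ 3 * c = 0) -> [/\ a = 0, b = 0 & c = 0].
Proof.
move=> h; have := h 1; have := h (-1); have := h 2.
by move=> h1 h2 h3; split; lra.
Qed.

(** Let p and q be dual to a and c in the plane that they span. View B and the
pencil P(t) as bilinear forms, and a and c as linear forms through the inner
product. The relation P(p,p) P(w,z) = P(p,z) P(w,p), a vanishing minor, is
polynomial in t: the coefficient of t^3 gives B(p,p) = 0, that of t gives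
B(w,z) = a(z) B(w,p) + a(w) B(p,z), and that of t^2 gives
eps del c(w) c(z) = B(p,z) B(w,p). So B(p,z) is proportional to c(z), with a
factor of square eps del, and two signs whose product is a square agree. *)
Lemma rank1_pencil (R : realType) (n : nat) (a c : 'cV[R]_n) (B : 'M[R]_n)
    (eps del : R) :
  eps ^+ 2 = 1 -> del ^+ 2 = 1 -> B^T = B ->
  a != 0 -> (forall k, c != k *: a) ->
  (forall t, exists (k : R) (d : 'cV[R]_n),
     eps *: (a *m a^T) + t *: B + t ^+ 2 *: (del *: (c *m c^T)) =
     k *: (d *m d^T)) ->
  eps = del /\
  exists kap, kap ^+ 2 = 1 /\ B = kap *: (a *m c^T + c *m a^T).
Proof.
move=> eps1 del1 symB a0 indep rk.
pose b u v := dot u (B *m v).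
have bC u v : b u v = b v u.
  by rewrite /b dotC /dot trmx_mul symB mulmxA.
have minor t p w z :
    (eps * dot p a * dot p a + t * b p p + t ^+ 2 * (del * dot p c * dot p c)) *
    (eps * dot w a * dot z a + t * b w z + t ^+ 2 * (del * dot w c * dot z c)) =
    (eps * dot p a * dot z a + t * b p z + t ^+ 2 * (del * dot p c * dot z c)) *
    (eps * dot w a * dot p a + t * b w p + t ^+ 2 * (del * dot w c * dot p c)).
  have [k [d E]] := rk t.
  have form u v : eps * dot u a * dot v a + t * b u v +
      t ^+ 2 * (del * dot u c * dot v c) = k * dot u d * dot v d.
    rewrite -[RHS]dot_outer -E !mulmxDl !dotDr -!scalemxAl !mul_outer !dotZr.
    by rewrite (dotC a v) (dotC c v) /b; ring.
  by rewrite !form; ring.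
have cc : dot c c != 0.
  by rewrite dot_eq0; have := indep 0; rewrite scale0r.
have aa : dot a a != 0 by rewrite dot_eq0.
have [p [pa pc]] : exists p, dot p a = 1 /\ dot p c = 0.
  pose p := a - (dot a c / dot c c) *: c.
  have p0 : dot p p != 0.
    rewrite dot_eq0 subr_eq0; apply/eqP => aE.
    have k0 : dot a c / dot c c != 0.
      by apply: contraNneq a0 => k0; rewrite aE k0 scale0r.
    have /eqP[] := indep (dot a c / dot c c)^-1.
    by rewrite {2}aE scalerA mulVf // scale1r.
  have pc : dot p c = 0 by rewrite dotBl dotZl mulfVK // subrr.
  have pa : dot p a = dot p p by rewrite {3}/p dotBr dotZr pc mulr0 subr0.
  exists ((dot p p)^-1 *: p); rewrite !dotZl pc mulr0 pa.
  by rewrite mulVf.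
have [q [qa qc]] : exists q, dot q a = 0 /\ dot q c = 1.
  pose q := c - (dot c a / dot a a) *: a.
  have q0 : dot q q != 0 by rewrite dot_eq0 subr_eq0.
  have qa : dot q a = 0 by rewrite dotBl dotZl mulfVK // subrr.
  have qc : dot q c = dot q q by rewrite {3}/q dotBr dotZr qa mulr0 subr0.
  exists ((dot q q)^-1 *: q); rewrite !dotZl qa mulr0 qc.
  by rewrite mulVf.
have coef w z : [/\ eps * (b w z + b p p * dot w a * dot z a
      - dot z a * b w p - dot w a * b p z) = 0,
    eps * del * dot w c * dot z c + b p p * b w z - b p z * b w p = 0 &
    b p p * del * dot w c * dot z c = 0].
  apply: cubic_eq0 => t; have := minor t p w z; rewrite pa pc.
  move=> /eqP; rewrite -subr_eq0 => /eqP <-; ring.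
have eps0 : eps != 0 by rewrite -sqrf_eq0 eps1 oner_neq0.
have del0 : del != 0 by rewrite -sqrf_eq0 del1 oner_neq0.
have bpp : b p p = 0.
  have [_ _] := coef q q; rewrite qc !mulr1 => /eqP.
  by rewrite mulf_eq0 (negbTE del0) orbF => /eqP.
set kap := b p q.
have kap2 : kap ^+ 2 = eps * del.
  have [_ + _] := coef q q; rewrite bpp qc (bC q p) -/kap => h.
  by rewrite expr2; lra.
have kap0 : kap != 0.
  by rewrite -sqrf_eq0 kap2 mulf_neq0.
have bp z : b p z = kap * dot z c.
  have [_ + _] := coef q z; rewrite bpp qc (bC q p) -/kap -kap2 => h.
  by apply: (mulfI kap0); rewrite mulrA -expr2; lra.
have bE w z : b w z = kap * (dot w c * dot z a + dot w a * dot z c).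
  have [+ _ _] := coef w z; rewrite bpp (bC w p) !bp => /eqP.
  rewrite mulf_eq0 (negbTE eps0) => /eqP h; lra.
have ed : eps = del.
  have : 0 <= eps * del by rewrite -kap2 sqr_ge0.
  move: eps1 del1 => /eqP; rewrite sqrf_eq1 => /orP[]/eqP-> /eqP;
    rewrite sqrf_eq1 => /orP[]/eqP->; lra.
split=> //; exists kap; split; first by rewrite kap2 -ed -expr2.
apply: eq_dot_mx => u v; rewrite -[LHS]/(b u v) bE -scalemxAl mulmxDl.
by rewrite !mul_outer dotZr dotDr !dotZr (dotC c v) (dotC a v); ring.
Qed.

(** * Linear maps preserving rank one *)

Lemma rank_outer (R : realType) (n : nat) (x : 'cV[R]_n) :
  x != 0 -> \rank (x *m x^T) = 1%N.
Proof.
move=> x0; apply/eqP; rewrite eqn_leq mulmx_max_rank lt0n mxrank_eq0.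
by apply: contra x0 => /eqP/outer_eq0->.
Qed.

(** A rank one matrix is u v^T; symmetry makes u and v proportional, and the
absolute value of the factor is absorbed into the vector. *)
Lemma symmetric_rank1 (R : realType) (n : nat) (X : 'M[R]_n) :
  X^T = X -> \rank X = 1%N ->
  exists (eps : R) (d : 'cV[R]_n),
    [/\ eps ^+ 2 = 1, d != 0 & X = eps *: (d *m d^T)].
Proof.
move=> symX rX; have X0 : X != 0 by rewrite -mxrank_eq0 rX.
have [u [v XE]] : exists (u : 'cV[R]_n) (v : 'cV[R]_n), X = u *m v^T.
  move: (mulmx_base X); move: (col_base X) (row_base X); rewrite rX => u v <-.
  by exists u, v^T; rewrite trmxK.
have v0 : v != 0 by apply: contra_neq X0 => v0; rewrite XE v0 trmx0 mulmx0.
have vv : dot v v != 0 by rewrite dot_eq0.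
set k := dot u v / dot v v.
have uE : u = k *: v.
  have Xv : dot v v *: u = dot u v *: v.
    by rewrite -!mul_outer -XE -symX XE trmx_mul trmxK.
  by rewrite /k mulrC -scalerA -Xv scalerA mulVf // scale1r.
have k0 : k != 0.
  by apply: contra_neq X0 => k0; rewrite XE uE k0 scale0r mul0mx.
exists (Num.sg k), (Num.sqrt `|k| *: v); split.
- by rewrite sqr_sg k0.
- by rewrite scaler_eq0 negb_or v0 andbT sqrtr_eq0 -ltNge normr_gt0.
rewrite XE uE linearZ /= -!scalemxAl -scalemxAr !scalerA -mulrA -expr2.
by rewrite sqr_sqrtr // -numEsg.
Qed.

Lemma outer_symmx (R : realType) (n : nat) (x : 'cV[R]_n) :
  x *m x^T \in @symmx R n.
Proof. by apply/symmxP; rewrite trmx_mul trmxK. Qed.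

Definition outer (R : realType) (n : nat) (x : 'cV[R]_n) : symm R n :=
  Symm (outer_symmx x).

Lemma polar_symmx (R : realType) (n : nat) (x y : 'cV[R]_n) :
  x *m y^T + y *m x^T \in @symmx R n.
Proof.
by apply/symmxP; rewrite linearD /= !trmx_mul !trmxK addrC.
Qed.

(** The coefficient of t in the outer square of x + t y. *)
Definition polar (R : realType) (n : nat) (x y : 'cV[R]_n) : symm R n :=
  Symm (polar_symmx x y).

Lemma outerD (R : realType) (n : nat) (t : R) (x y : 'cV[R]_n) :
  outer (x + t *: y) = outer x + t *: polar x y + t ^+ 2 *: outer y.
Proof.
apply/val_inj; rewrite !linearD !linearZ /=.
rewrite [(_ + _)^T]linearD /= [(_ *: _)^T]linearZ /=.
rewrite mulmxDl !mulmxDr -!scalemxAl -!scalemxAr scalerA -expr2.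
by rewrite scalerDr !addrA.
Qed.

Lemma outerZ (R : realType) (n : nat) (k : R) (x : 'cV[R]_n) :
  outer (k *: x) = k ^+ 2 *: outer x.
Proof.
apply/val_inj; rewrite linearZ /= [(_ *: _)^T]linearZ /=.
by rewrite -scalemxAl -scalemxAr scalerA expr2.
Qed.

Lemma polarZ (R : realType) (n : nat) (k : R) (x y : 'cV[R]_n) :
  polar x (k *: y) = k *: polar x y.
Proof.
apply/val_inj; rewrite linearZ /= [(_ *: _)^T]linearZ /=.
by rewrite -scalemxAl -scalemxAr scalerDr.
Qed.

Lemma polarD (R : realType) (n : nat) (x y z : 'cV[R]_n) :
  polar x (y + z) = polar x y + polar x z.
Proof.
apply/val_inj; rewrite linearD /= [(_ + _)^T]linearD /= mulmxDl mulmxDr.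
by rewrite addrACA.
Qed.

Lemma polarxx (R : realType) (n : nat) (x : 'cV[R]_n) :
  polar x x = 2 *: outer x.
Proof. by apply/val_inj; rewrite linearZ /= scaler_nat. Qed.

(** This makes the vector attached to z by [preserver_polar] unique, hence
linear in z. *)
Lemma polar_inj (R : realType) (n : nat) (a : 'cV[R]_n) :
  a != 0 -> injective (polar a).
Proof.
move=> a0; suff polar0 c : polar a c = 0 -> c = 0.
  move=> c d cd; apply/eqP; rewrite -subr_eq0; apply/eqP/polar0.
  by rewrite -scaleN1r polarD polarZ scaleN1r cd subrr.
move=> /(congr1 (fun X : symm R n => X *m a)).
rewrite /= mulmxDl !mul_outer mul0mx => E.
have aa : dot a a != 0 by rewrite dot_eq0.
have ca : dot c a = 0.
  have := congr1 (dot a) E; rewrite -[in RHS](scale0r a) dotDr !dotZr mul0r.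
  rewrite (dotC a c) => h; apply: (mulfI aa); lra.
move: E; rewrite ca scale0r add0r => /eqP.
by rewrite scaler_eq0 (negbTE aa) => /eqP.
Qed.

Lemma outer_proportional (R : realType) (n : nat) (k : R) (x z : 'cV[R]_n) :
  outer z = k *: outer x -> exists l, z = l *: x.
Proof.
have [-> _|z0] := eqVneq z 0; first by exists 0; rewrite scale0r.
move=> /(congr1 (fun X : symm R n => X *m z)).
rewrite /= -scalemxAl !mul_outer => E.
exists ((dot z z)^-1 * (k * dot x z)).
by rewrite -[in RHS]scalerA -[in RHS]scalerA -E scalerA mulVf ?scale1r ?dot_eq0.
Qed.

Lemma symm_mx_sum (R : realType) (n : nat) (I : finType) (F : I -> symm R n) :
  symm_mx (\sum_i F i) = \sum_i symm_mx (F i).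
Proof. exact: (raddf_sum (\val : symm R n -> 'M[R]_n)). Qed.

Lemma symm_sum_outer (R : realType) (n : nat) (X : symm R n) :
  exists (w : 'I_n -> R) (v : 'I_n -> 'cV[R]_n), X = \sum_k w k *: outer (v k).
Proof.
have [cX _] := lambdaP X.
have [V [_ XE]] := orthogonal_diagonalization (symmxP _ (valP X)) cX.
exists (fun k => lambda X k 0), (fun k => col k V).
apply/val_inj; rewrite [LHS]XE raddf_sum /=; apply/matrixP => i j.
rewrite mul_mx_diag !mxE summxE; apply: eq_bigr => k _.
by rewrite !mxE big_ord1 !mxE; ring.
Qed.

Lemma preserver_outer (R : realType) (n : nat)
    (L : {linear symm R n -> symm R n}) (x : 'cV[R]_n) :
  rank1_preserver L -> x != 0 ->
  exists (eps : R) (a : 'cV[R]_n),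
    [/\ eps ^+ 2 = 1, a != 0 & L (outer x) = eps *: outer a].
Proof.
move=> rankL x0; have := rankL (outer x) (rank_outer x0).
move=> /(symmetric_rank1 (symmxP _ (valP _)))[eps [a [eps1 a0 E]]].
by exists eps, a; split=> //; apply/val_inj; rewrite linearZ.
Qed.

(** The vector attached to z depends on the choice of a sign; the second
equation fixes it coherently for all z, by comparison with the fixed
vector x. *)
Lemma preserver_polar (R : realType) (n : nat)
    (L : {linear symm R n -> symm R n}) (x a z : 'cV[R]_n) (eps : R) :
  injective L -> rank1_preserver L ->
  x != 0 -> a != 0 -> eps ^+ 2 = 1 -> L (outer x) = eps *: outer a ->
  exists c, L (outer z) = eps *: outer c /\ L (polar x z) = eps *: polar a c.
Proof.
move=> injL rankL x0 a0 eps1 Lx.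
have [[k ->]|indep] := pselect (exists k, z = k *: x).
  exists (k *: a); rewrite !outerZ !polarZ !polarxx !linearZ /= Lx.
  by rewrite !scalerA; split; congr (_ *: _); ring.
have {}indep k : z <> k *: x by move=> zk; apply: indep; exists k.
have z0 : z != 0 by apply/eqP; have := indep 0; rewrite scale0r.
have [del [c [del1 c0 Lz]]] := preserver_outer rankL z0.
(* L is injective: proportional images come from proportional squares. *)
have indep' k : c != k *: a.
  apply/eqP => ck; have [l /indep//] : exists l, z = l *: x.
  apply: (@outer_proportional _ _ (del * k ^+ 2 * eps)); apply: injL.
  rewrite linearZ /= Lz Lx ck outerZ !scalerA -[_ * eps * eps]mulrA -expr2.
  by rewrite eps1 mulr1.
have pencil t : exists (k : R) (d : 'cV[R]_n),
    eps *: (a *m a^T) + t *: symm_mx (L (polar x z)) +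
    t ^+ 2 *: (del *: (c *m c^T)) = k *: (d *m d^T).
  have xt0 : x + t *: z != 0.
    have [->|t0] := eqVneq t 0; first by rewrite scale0r addr0.
    apply/eqP => /eqP; rewrite addr_eq0 => /eqP xz.
    apply: (indep (- t^-1)).
    by rewrite xz scaleNr scalerN opprK scalerA mulVf // scale1r.
  have [k [d [_ _ E]]] := preserver_outer rankL xt0.
  exists k, d; have := congr1 (@symm_mx R n) E.
  by rewrite outerD !linearD !linearZ /= Lx Lz /= !scalerA (mulrC del).
have [ed [kap [kap1 BE]]] :=
  rank1_pencil eps1 del1 (symmxP _ (valP _)) a0 indep' pencil.
(* eps kap = 1 or -1: this factor keeps c c^T and corrects the sign of B. *)
exists ((eps * kap) *: c); rewrite outerZ polarZ exprMn eps1 kap1 mulr1.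
split; first by rewrite scale1r ed.
rewrite scalerA mulrA -expr2 eps1 mul1r.
by apply/val_inj; rewrite linearZ.
Qed.

(** The map f that sends z to the vector of [preserver_polar] is linear by
[polar_inj], and M is its matrix. A vector r in the kernel of M would give
L(r r^T) = 0, so M is invertible because L is injective. *)
Lemma rank1_preserver_congr (R : realType) (n : nat)
    (L : {linear symm R n -> symm R n}) :
  injective L -> rank1_preserver L ->
  exists (M : 'M[R]_n) (alpha : R),
    [/\ M \in unitmx, alpha = -1 \/ alpha = 1
      & forall X : symm R n, L X = alpha *: congr_op M X].
Proof.
case: n L => [|n] L injL rankL.
  exists 1%:M, 1; split; [exact: unitmx1 | by right |].
  by move=> X; apply/val_inj/matrixP => -[].
pose x : 'cV[R]_n.+1 := const_mx 1.
have x0 : x != 0.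
  apply/eqP => /matrixP/(_ 0 0)/eqP; rewrite !mxE; exact/negP/oner_neq0.
have [eps [a [eps1 a0 Lx]]] := preserver_outer rankL x0.
have /choice[f fE] := fun z => preserver_polar z injL rankL x0 a0 eps1 Lx.
have eps0 : eps != 0 by rewrite -sqrf_eq0 eps1 oner_neq0.
have fZ k u : f (k *: u) = k *: f u.
  apply: (polar_inj a0); apply: (scalerI eps0).
  rewrite polarZ scalerA mulrC -scalerA -!(proj2 (fE _)).
  by rewrite polarZ linearZ.
have fD u v : f (u + v) = f u + f v.
  apply: (polar_inj a0); apply: (scalerI eps0).
  rewrite polarD scalerDr -!(proj2 (fE _)).
  by rewrite polarD linearD.
have f0 : f 0 = 0 by have := fZ 0 0; rewrite !scale0r.
pose M := \matrix_(i, j) f (delta_mx j 0) i 0.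
have fM z : f z = M *m z.
  rewrite [z in LHS]matrix_sum_delta.
  under eq_bigr do rewrite big_ord1.
  rewrite (big_morph f fD f0); apply/colP => i; rewrite summxE mxE.
  by apply: eq_bigr => j _; rewrite fZ !mxE mulrC.
have LM X : L X = eps *: congr_op M X.
  have [w [v ->]] := symm_sum_outer X; rewrite linear_sum.
  apply/val_inj; rewrite linearZ /= !symm_mx_sum mulmx_sumr mulmx_suml.
  rewrite scaler_sumr; apply: eq_bigr => k _; rewrite linearZ /=.
  rewrite (proj1 (fE _)) /= fM trmx_mul !mulmxA -scalemxAr -scalemxAl.
  by rewrite !mulmxA !scalerA mulrC.
exists M, eps; split => //.
- rewrite -unitmx_tr unitmxE unitfE; apply/det0P => -[r r0 rM].
  have Mr : M *m r^T = 0 by rewrite -[LHS]trmxK trmx_mul trmxK rM trmx0.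
  have : outer r^T = 0.
    apply: injL; rewrite linear0 (proj1 (fE _)) fM Mr -(scale0r 0) outerZ.
    by rewrite expr0n scale0r scaler0.
  move=> /(congr1 (@symm_mx R n.+1))/outer_eq0/eqP.
  by rewrite trmx_eq0 (negbTE r0).
- by move/eqP: eps1; rewrite sqrf_eq1 => /orP[]/eqP; [right|left].
Qed.

(** * Symmetrization in convex cones and the sign of alpha *)

(** x + y is twice the midpoint of x and y. *)
Lemma convex_cone_add (R : realType) (V : lmodType R) (K : set V) (x y : V) :
  convex_cone K -> K x -> K y -> K (x + y).
Proof.
move=> [[_ coneK] convK] Kx Ky.
have h0 : 0 <= 2^-1 :> R by lra.
have h1 : 2^-1 <= 1 :> R by lra.
have := convK x y (Itv01 h0 h1); rewrite !inE => /(_ Kx Ky).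
rewrite -[conv _ _ _]/(2^-1 *: x + (1 - 2^-1) *: y).
rewrite (_ : 1 - 2^-1 = 2^-1); last by lra.
rewrite -scalerDr.
by move=> /(coneK 2 _ (ler0n _ 2)); rewrite scalerA divff ?scale1r.
Qed.

Lemma convex_cone_sum (R : realType) (V : lmodType R) (K : set V)
    (I : finType) (P : pred I) (f : I -> V) :
  convex_cone K -> (forall i, P i -> K (f i)) -> K (\sum_(i | P i) f i).
Proof.
move=> convK Kf; apply: big_ind => //; last by move=> *; exact: convex_cone_add.
by have [[[x Kx] coneK] _] := convK; rewrite -(scale0r x); exact: coneK.
Qed.

(** A vector invariant under all permutations is constant. *)
Lemma symmetrization (R : realType) (n : nat) (x : 'cV[R]_n) :
  exists c : R, \sum_(s : 'S_n) perm_mx s *m x = const_mx c.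
Proof.
case: n x => [|n] x; first by exists 0; apply/colP => -[].
exists (\sum_(s : 'S_n.+1) x (s ord0) 0); apply/colP => i.
rewrite summxE mxE (reindex_inj (mulgI (tperm ord0 i))) /=.
apply: eq_bigr => s _; rewrite -row_permE mxE permM tpermR.
by congr (x (s _) _); rewrite tpermR.
Qed.

(** M M^T is positive definite: the eigenvalue of a unit eigenvector v is the
squared length of M^T v. *)
Lemma spectral_set_scalar (R : realType) (n : nat) (K : set 'cV[R]_n)
    (M : 'M[R]_n) (X : symm R n) (k : R) :
  permutation_invariant K -> M \in unitmx -> symm_mx X = k *: (M *m M^T) ->
  spectral_set K X ->
  exists w : 'cV[R]_n, K (k *: w) /\ forall i, 0 < w i 0.
Proof.
move=> permK uM XE KX.
have symG : M *m M^T \in @symmx R n by apply/symmxP; rewrite trmx_mul trmxK.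
have [cG _] := lambdaP (Symm symG).
have [V [VV GE]] := orthogonal_diagonalization (symmxP _ symG) cG.
set w := lambda (M *m M^T) in cG GE.
exists w; split.
  apply/(spectral_set_congr _ permK VV).
  suff <- : X = congr_op V (diag_symm (k *: w)) by [].
  apply/val_inj; rewrite /= -[LHS]/(symm_mx X) XE GE /=.
  rewrite scalemxAl scalemxAr -linearZ /=; congr (_ *m diag_mx _ *m _).
  by apply/rowP => i; rewrite !mxE.
move=> i; pose A := M^T *m V.
have uA : A \in unitmx.
  by rewrite unitmx_mul unitmx_tr uM; case/mulmx1_unit: VV.
have -> : w i 0 = dot (col i A) (col i A).
  have AA : A^T *m A = diag_mx w^T.
    rewrite trmx_mul trmxK mulmxA -(mulmxA V^T) GE !mulmxA VV mul1mx.
    by rewrite -mulmxA VV mulmx1; congr diag_mx; apply/rowP => j; rewrite !mxE.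
  have := congr1 (fun B : 'M[R]_n => B i i) AA.
  rewrite mxE [RHS]mxE eqxx mulr1n mxE => <-; rewrite dotE.
  by apply: eq_bigr => j _; rewrite !mxE.
rewrite dot_gt0 colE; apply/eqP => /(congr1 (mulmx (invmx A))).
rewrite mulKmx // mulmx0 => /(congr1 (fun u : 'cV[R]_n => u i 0))/eqP.
by rewrite !mxE !eqxx oner_eq0.
Qed.

(** Suppose alpha negative and let c be the nonzero value of a constant vector
of K. The image of c I is alpha c M M^T, so K contains alpha c w with w
positive, and by averaging a constant vector of sign opposite to c: K is not
pointed. *)
Lemma pointed_congr_sign (R : realType) (n : nat) (K : set 'cV[R]_n)
    (L : {linear symm R n -> symm R n}) (M : 'M[R]_n) (alpha : R) :
  permutation_invariant K -> convex_cone K -> K <> [set 0] -> pointed K ->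
  (forall X, spectral_set K X -> spectral_set K (L X)) ->
  M \in unitmx -> (forall X : symm R n, L X = alpha *: congr_op M X) ->
  0 <= alpha.
Proof.
move=> permK convK K0 pointK LK uM LE; rewrite leNgt; apply/negP => alpha_lt0.
have [[[z Kz] coneK] _] := convK.
have Kopp x : K x -> K (- x) -> x = 0.
  move=> Kx KNx; have : (K `&` [set - x | x in K]) x.
    by split=> //; exists (- x); rewrite ?opprK.
  by rewrite pointK.
have Kperm s x : K x -> K (perm_mx s *m x).
  by move=> Kx; rewrite -[K](permK s); exists x.
have Ksym x c : K x -> \sum_(s : 'S_n) perm_mx s *m x = const_mx c ->
    K (const_mx c).
  by move=> Kx <-; apply: convex_cone_sum => // s _; exact: Kperm.
have [x [Kx x0]] : exists x, K x /\ x <> 0.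
  apply: contra_notP K0 => /forallNP h; apply/seteqP; split=> [x Kx|_ ->].
    by apply: contrapT => x0; apply: (h x).
  by rewrite -(scale0r z); exact: coneK.
have [i0 _] : exists i, x i 0 <> 0.
  apply: contra_notP x0 => /forallNP h; apply/colP => i; rewrite mxE.
  exact: contrapT (h i).
have [c cE] := symmetrization x.
(* If the images of x had sum 0, then -x would be the sum of the images of x
   other than x itself. *)
have c0 : c != 0.
  apply/eqP => c0; apply: x0; apply: Kopp => //.
  have -> : - x = \sum_(s : 'S_n | s != 1%g) perm_mx s *m x.
    move: cE; rewrite (bigD1 1%g) //= perm_mx1 mul1mx c0 => /eqP.
    by rewrite addrC addr_eq0 => /eqP ->.
  by apply: convex_cone_sum => // s _; exact: Kperm.
have Kc := Ksym _ _ Kx cE.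
have KcI : spectral_set K (congr_op 1%:M (diag_symm (const_mx c))).
  by apply/spectral_set_congr; rewrite ?trmx1 ?mulmx1.
have [w [Kw w0]] : exists w : 'cV[R]_n,
    K ((alpha * c) *: w) /\ forall i, 0 < w i 0.
  apply: spectral_set_scalar (LK _ KcI) => //; first exact: uM.
  rewrite LE /= trmx1 mul1mx mulmx1.
  have -> : diag_mx (const_mx c)^T = c%:M :> 'M[R]_n.
    by rewrite -diag_const_mx; congr diag_mx; apply/rowP => i; rewrite !mxE.
  by rewrite mul_mx_scalar -scalemxAl scalerA.
have [d dE] := symmetrization w.
have d0 : 0 < d.
  have := congr1 (fun u : 'cV[R]_n => u i0 0) dE; rewrite mxE => <-.
  rewrite summxE (bigD1 1%g) //= ltr_pwDl // ?perm_mx1 ?mul1mx //.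
  by apply: sumr_ge0 => s _; rewrite -row_permE mxE ltW.
have Kd : K (const_mx (alpha * c * d)).
  apply: Ksym Kw _; under eq_bigr do rewrite -scalemxAr.
  by rewrite -scaler_sumr dE scalemx_const.
have : const_mx c = 0 :> 'cV[R]_n.
  apply: Kopp => //.
  have -> : - const_mx c =
      (- (alpha * d))^-1 *: const_mx (alpha * c * d) :> 'cV[R]_n.
    apply/colP => i; rewrite !mxE; field.
    by rewrite (lt0r_neq0 d0) (ltr0_neq0 alpha_lt0).
  by apply: coneK => //; rewrite invr_ge0 oppr_ge0 mulr_le0_ge0 // ltW.
by move=> /colP/(_ i0)/eqP; rewrite !mxE (negbTE c0).
Qed.

Unset Implicit Arguments.

Theorem theorem4p4 (R : realType) (n : nat) (K : set 'cV[R]_n)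
    (L : {linear symm R n -> symm R n})
    (hperm : permutation_invariant K) (hclosed : closed K)
    (hcone : convex_cone K) (hL : in_Aut (spectral_set K) L) :
  (forall (M : 'M[R]_n) (alpha : R),
      M \in unitmx -> alpha = -1 \/ alpha = 1 ->
      (forall X : symm R n, L X = alpha *: congr_op M X) ->
      forall D : 'M[R]_n,
        is_diag_mx D ->
        (exists s : 'S_n, forall i, D i i = singular_values M (s i) 0) ->
        in_Aut K (mulmx (alpha *: (D *m D)) : {linear 'cV[R]_n -> 'cV[R]_n}))
  /\
  (rank1_preserver L ->
    (exists (M : 'M[R]_n) (alpha : R),
        [/\ M \in unitmx, alpha = -1 \/ alpha = 1
          & forall X : symm R n, L X = alpha *: congr_op M X])
    /\
    (K <> [set 0] -> pointed K ->
      forall (M : 'M[R]_n) (alpha : R),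
        M \in unitmx -> alpha = -1 \/ alpha = 1 ->
        (forall X : symm R n, L X = alpha *: congr_op M X) ->
        alpha = 1)).
Proof.
split=> [M alpha uM alpha1 LE D diagD [s DE]|rankL].
  apply: (diagonal_in_Aut hperm hL uM _ LE diagD DE).
  by case: alpha1 => ->; rewrite ?oppr_eq0 oner_neq0.
split; first exact: rank1_preserver_congr (bij_inj hL.1) rankL.
move=> K0 pointK M alpha uM alpha1 LE.
have LK X : spectral_set K X -> spectral_set K (L X).
  by move=> KX; apply/(in_Aut_iff hL).
have := pointed_congr_sign hperm hcone K0 pointK LK uM LE.
by case: alpha1 => -> //; rewrite oppr_ge0 ler10.
Qed.
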